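(* Let $0<q<1$, let $a,b,c,d,r$ be complex numbers with $\max\{|a|,|b|,|c|,|d|,|r|\}<1$, and put $\alpha=a^2bcdr/q$. Then \begin{align*} &\sum_{n=0}^\infty \frac{( ab, ac, ad, ar; q)_n (bcdr)^n}{(q, \sqrt{q\alpha}, -\sqrt{q\alpha}, abcd, abcr; q)_n}\, {}_3\phi_2\left({{abq^n, acq^n, bc}\atop{abcdq^n, abcrq^n}}; q, dr\right)\\ &=\frac{(abdr, acdr; q)_\infty}{( dr, q\alpha; q)_\infty} \sum_{n=0}^\infty \frac{(-\alpha)^n(1-\alpha q^{4n})(\alpha, ab, ac, ad, ar; q)_{2n} (q; q^2)_n}{(1-\alpha)(q, abcd, abcr, abdr, acdr; q)_{2n} (q\alpha; q^2)_n} (bcdr)^{2n} q^{3n^2-n}. \end{align*}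
   Context: For $0<q<1$ and base $p\in\{q,q^2\}$: $(a;p)_n=\prod_{k=0}^{n-1}(1-ap^k)$, $(a;p)_\infty=\prod_{k\ge0}(1-ap^k)$, $(a_1,\dots,a_m;p)_n=(a_1;p)_n\cdots(a_m;p)_n$. ${}_{3}\phi_2\left({{a_1,a_2,a_3}\atop{b_1,b_2}};q,z\right)=\sum_{n\ge0}\frac{(a_1,a_2,a_3;q)_n}{(q,b_1,b_2;q)_n}z^n$, and $\sqrt{q\alpha}$ denotes a fixed square root. *)

(* Defs.v *)
From mathcomp Require Export all_boot all_order all_algebra.
From mathcomp Require Export all_classical all_reals all_analysis.
From mathcomp Require Export complex.
Set Implicit Arguments.
Unset Strict Implicit.
Unset Printing Implicit Defensive.
Export Order.TTheory GRing.Theory Num.Theory.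
Export numFieldNormedType.Exports.
Local Open Scope classical_set_scope.
Local Open Scope ring_scope.

Section QSeries.
Variable K : numFieldType.
Implicit Types (a z p : K) (s : seq K) (n : nat).

Definition qpoch a p n : K := \prod_(k < n) (1 - a * p ^+ k).

Definition qpochs s p n : K := \prod_(a <- s) qpoch a p n.

Definition qpoch_inf a p : K := limn (qpoch a p).

Definition qpochs_inf s p : K := \prod_(a <- s) qpoch_inf a p.

Definition phi32_term (a1 a2 a3 b1 b2 p z : K) n : K :=
  qpochs [:: a1; a2; a3] p n / qpochs [:: p; b1; b2] p n * z ^+ n.

Definition phi32 (a1 a2 a3 b1 b2 p z : K) : K :=
  limn (series (phi32_term a1 a2 a3 b1 b2 p z)).

Definition vwp_quot p n (x : K) : K :=
  (1 - x * p ^+ (4 * n)) * qpoch x p (2 * n) / (1 - x).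

(* The quotient (1 - x p^(4n)) (x;p)_(2n) / (1 - x) is a polynomial in x.
   At x = 1, where division by zero would return 0, it takes its limit. *)
Definition vwp p n (x : K) : K :=
  if x == 1 then lim (vwp_quot p n y @[y --> (1 : K)^']) else vwp_quot p n x.

(* s is a square root of q * alpha. *)
Definition lhs_term (q a b c d r s : K) n : K :=
  qpochs [:: a * b; a * c; a * d; a * r] q n * (b * c * d * r) ^+ n
  / qpochs [:: q; s; - s; a * b * c * d; a * b * c * r] q n
  * phi32 (a * b * q ^+ n) (a * c * q ^+ n) (b * c)
      (a * b * c * d * q ^+ n) (a * b * c * r * q ^+ n) q (d * r).

Definition rhs_term (q a b c d r alpha : K) n : K :=
  (- alpha) ^+ n * vwp q n alpha
  * qpochs [:: a * b; a * c; a * d; a * r] q (2 * n) * qpoch q (q ^+ 2) n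
  / (qpochs [:: q; a * b * c * d; a * b * c * r; a * b * d * r; a * c * d * r]
       q (2 * n)
     * qpoch (q * alpha) (q ^+ 2) n)
  * (b * c * d * r) ^+ (2 * n) * q ^+ (3 * n ^ 2 - n).

End QSeries.

(* Main.v *)
(* Write x = ab, y = ac, u = ad, v = ar, w = bc, z = dr and b' = q alpha, so that
   b' = xyz = uvw.  The limit of Watson's transformation of a very-well-poised
   8phi7 turns each inner 3phi2 into an infinite product times a very-well-poised
   series with alpha replaced by alpha q^(2n).  Summing the resulting double
   series along its diagonals (a Bailey-type exchange) leaves, for each N, the
   limit c -> 0 of Andrews' terminating q-Watson sum, which vanishes for N odd and
   is a product for N even.  Watson's limit itself follows from the same exchange,
   combining the q-Pfaff-Saalschuetz sum with the limiting 6phi5 sum.  The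
   recurrences behind the two terminating sums (S_(k+1) against S_k, resp. S_(N+2)
   against S_N) and the q-difference equation in z of the 6phi5 all telescope. *)
Require Import Defs.
From mathcomp Require Import ring zify.
Set Implicit Arguments.
Unset Strict Implicit.
Unset Printing Implicit Defensive.
Local Open Scope classical_set_scope.
Local Open Scope ring_scope.
Local Open Scope complex_scope.

Section Algebra.
Variable K : numFieldType.
Implicit Types (a b q u v w x y z : K) (k m n : nat).

(** * Finite q-shifted factorials and the very-well-poised factor *)

Lemma qpoch0 a q : qpoch a q 0 = 1.
Proof. by rewrite /qpoch big_ord0. Qed.

Lemma qpochS a q n : qpoch a q n.+1 = qpoch a q n * (1 - a * q ^+ n).
Proof. by rewrite /qpoch big_ord_recr. Qed.

Lemma qpochD a q m n :
  qpoch a q (m + n) = qpoch a q m * qpoch (a * q ^+ m) q n.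
Proof.
elim: n => [|n IH]; first by rewrite addn0 qpoch0 mulr1.
by rewrite addnS !qpochS IH exprD; ring.
Qed.

Lemma qpochSl a q n : qpoch a q n.+1 = (1 - a) * qpoch (a * q) q n.
Proof. by rewrite -add1n qpochD qpochS qpoch0 expr0 expr1 mul1r mulr1. Qed.

Lemma qpoch_sqr a q n : qpoch a q n * qpoch (- a) q n = qpoch (a ^+ 2) (q ^+ 2) n.
Proof.
elim: n => [|n IH]; first by rewrite !qpoch0 mulr1.
by rewrite !qpochS -IH exprAC; ring.
Qed.

Lemma qfactor_neq0 a q n : `|a| < 1 -> `|q| <= 1 -> 1 - a * q ^+ n != 0.
Proof.
move=> a1 q1; rewrite subr_eq0; apply/eqP => /(congr1 Num.norm) /eqP.
rewrite normr1 normrM normrX eq_sym lt_eqF//.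
by apply: le_lt_trans a1; rewrite ler_piMr// exprn_ile1.
Qed.

Lemma qpoch_neq0 a q n : `|a| < 1 -> `|q| <= 1 -> qpoch a q n != 0.
Proof. by move=> a1 q1; apply/prodf_neq0 => k _; exact: qfactor_neq0. Qed.

(* The factor (1 - x q^(2k)) (x; q)_k / (1 - x) of a very-well-poised series,
   with b = x q and without the removable singularity at x = 1. *)
Definition vwfac q b k : K :=
  if k is k'.+1 then (1 - b * q ^+ (2 * k').+1) * qpoch b q k' else 1.

(** For n + k > 0 both sides equal (1 - b q^(2(n+k)-1)) (b; q)_(2n+k-1). This moves a term of row
    [n] of the double series into a form whose very-well-poised factor depends on the diagonal
    [n + k] only. *)
Lemma vwfac_shift q b n k : q != 0 ->
  qpoch b q (2 * n) * vwfac q (b * q ^+ (2 * n)) k =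
  vwfac q b (n + k) * qpoch (b / q * q ^+ (n + k)) q n.
Proof.
move=> q0; have qq m : b / q * q ^+ m.+1 = b * q ^+ m.
  by rewrite exprS; field.
case: k => [|k].
  case: n => [|n]; first by rewrite muln0 !qpoch0.
  rewrite addn0 /vwfac qq mulr1.
  have -> : (2 * n.+1)%N = (n + n.+1).+1 by lia.
  by rewrite qpochS qpochD mul2n -addnn addnS; ring.
rewrite addnS /vwfac qq.
rewrite mulrCA -qpochD -[RHS]mulrA -qpochD (_ : n + k + n = 2 * n + k)%N; last by lia.
by rewrite -mulrA -exprD (_ : 2 * n + (2 * k).+1 = (2 * (n + k)).+1)%N //; lia.
Qed.

(** The limit of (f; q)_k / (f^k (q; q)_k) as f -> oo: the trace of a numerator parameter sent to
    infinity. *)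
Definition qcoef q k : K := (-1) ^+ k * q ^+ 'C(k, 2) / qpoch q q k.

Lemma binS2 k : 'C(k.+1, 2) = ('C(k, 2) + k)%N.
Proof. by rewrite binS bin1. Qed.

Lemma qcoefS q k : `|q| < 1 ->
  qcoef q k.+1 = - q ^+ k / (1 - q ^+ k.+1) * qcoef q k.
Proof.
move=> q1; have := qfactor_neq0 k q1 (ltW q1); rewrite -exprS => h.
have := qpoch_neq0 k q1 (ltW q1) => h2.
by rewrite /qcoef binS2 exprD qpochS -exprS exprS; field; rewrite h h2.
Qed.

(** * The limiting 6phi5: q-difference equation for its partial sums *)

(** Parametrised by alpha q = xyz, so that the lower parameters alpha q/x and alpha q/y become yz
    and xz; the third numerator parameter is at infinity. *)
Definition phi65_term q x y z k : K :=
  vwfac q (x * y * z) k * qcoef q k *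
  (qpoch x q k * qpoch y q k / (qpoch (x * z) q k * qpoch (y * z) q k)
   * z ^+ k).

Lemma vwfac_rshift q b k :
  (1 - b) * vwfac q (b * q) k.+1 = (1 - b * q ^+ (2 * k.+1)) * qpoch b q k.+1.
Proof.
by rewrite /= qpochSl (_ : 2 * k.+1 = (2 * k).+2)%N ?exprS; [ring | lia].
Qed.

(** The right-hand side is the telescoping certificate: its increment in n is the next summand. It
    carries z^(n+1), hence vanishes in the limit. *)
Lemma phi65_telescope q x y z n :
  `|q| < 1 -> `|x * z| < 1 -> `|y * z| < 1 ->
  \sum_(k < n.+1) ((1 - y * z) * (1 - x * z) * phi65_term q x y z k
     - (1 - x * y * z) * (1 - z) * phi65_term q x y (z * q) k) =
  qpoch (x * y * z) q n * qcoef q n * q ^+ n *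
  (qpoch x q n.+1 * qpoch y q n.+1 * z ^+ n.+1) /
  (qpoch (x * z * q) q n * qpoch (y * z * q) q n).
Proof.
move=> q1 xz1 yz1; have q1' := ltW q1.
have mq1 w : `|w| < 1 -> `|w * q| < 1.
  by move=> w1; rewrite normrM mulr_ilt1.
elim: n => [|n IH].
  rewrite big_ord_recl big_ord0 /phi65_term /vwfac /qcoef !qpochS !qpoch0.
  by rewrite bin0n /= !expr0 expr1; field; rewrite ?oner_eq0.
rewrite big_ord_recr {}IH /=.
(* At [z * q] the very-well-poised factor has base xyzq; absorbing 1 - xyz brings it back to the
   factorials that occur at [z]. *)
have E k : (1 - x * y * z) * (1 - z) * phi65_term q x y (z * q) k.+1 =
   (1 - z) * ((1 - x * y * z * q ^+ (2 * k.+1)) * qpoch (x * y * z) q k.+1) *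
   qcoef q k.+1 * (qpoch x q k.+1 * qpoch y q k.+1
     / (qpoch (x * z * q) q k.+1 * qpoch (y * z * q) q k.+1)
   * (z * q) ^+ k.+1).
  by rewrite -vwfac_rshift /phi65_term !mulrA; ring.
have hx0 := qpoch_neq0 n (mq1 _ xz1) q1'.
have hy0 := qpoch_neq0 n (mq1 _ yz1) q1'.
have hx := qfactor_neq0 n (mq1 _ xz1) q1'.
have hy := qfactor_neq0 n (mq1 _ yz1) q1'.
have hx1 := qfactor_neq0 0 xz1 q1'.
have hy1 := qfactor_neq0 0 yz1 q1'.
have hq := qfactor_neq0 n q1 q1'.
rewrite expr0 mulr1 in hx1; rewrite expr0 mulr1 in hy1.
rewrite {}E /phi65_term /vwfac (qcoefS n q1).
rewrite (qpochSl (x * z)) (qpochSl (y * z)) !(qpochS _ _ n.+1) !(qpochS _ _ n).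
rewrite mulnS (exprS q (2 * n)) exprD exprM (exprAC q 2 n) !exprMn !exprS !expr0.
move: hx0 hy0 hx hy hx1 hy1 hq.
move: (qpoch (x * z * q) q n) (qpoch (y * z * q) q n) (qpoch (x * y * z) q n)
 (qpoch x q n) (qpoch y q n) (qcoef q n) (q ^+ n) (z ^+ n) => A B C D E F Q Z.
move=> hx0 hy0 hx hy hx1 hy1 hq.
by field; rewrite hx0 hy0 hx hy hx1 hy1 hq.
Qed.

(** * Terminating sums: q-Pfaff-Saalschuetz *)

(** Bailey inversion: for b = q alpha, [vwfac q b n * bailey_sum q b h n] is the alpha_n of the
    Bailey pair relative to alpha with beta_n = [h n]. *)
Definition bailey_sum q b (h : nat -> K) n : K :=
  \sum_(i < n.+1) qpoch (b / q * q ^+ n) q i * qcoef q (n - i) * h i.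

Lemma mulf_div_expS q b n : q != 0 -> b / q * q ^+ n.+1 = b * q ^+ n.
Proof. by move=> q0; rewrite exprS mulrA divfK. Qed.

Definition saal_coef q u v w n : K :=
  qpoch w q n / (qpoch q q n * qpoch (u * w) q n * qpoch (v * w) q n).

Lemma saal_coef0 q u v w : saal_coef q u v w 0 = 1.
Proof. by rewrite /saal_coef !qpoch0 !mulr1 divr1. Qed.

Lemma saal_coefS q u v w n : saal_coef q u v w n.+1 =
  saal_coef q u v w n * ((1 - w * q ^+ n) /
   ((1 - q * q ^+ n) * (1 - u * w * q ^+ n) * (1 - v * w * q ^+ n))).
Proof. by rewrite /saal_coef !qpochS !invfM; ring. Qed.

(* The q-Zeilberger certificate in summed form: partial sums of the recurrence
   relating the sums of order k + 1 and k, with k = j + m; likewise below. *)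
Lemma saal_partial q b u v w j m (k := (j + m)%N) : q != 0 -> `|q| < 1 ->
    `|u * w| < 1 -> `|v * w| < 1 -> b = u * v * w ->
  \sum_(i < j.+1)
    ((1 - q * q ^+ k) * (1 - u * w * q ^+ k) * (1 - v * w * q ^+ k) *
       (qpoch (b / q * q ^+ k.+1) q i * qcoef q (k.+1 - i) * saal_coef q u v w i)
     + q ^+ k * w * (1 - u * q ^+ k) * (1 - v * q ^+ k) *
       (qpoch (b / q * q ^+ k) q i * qcoef q (k - i) * saal_coef q u v w i)) =
  - qpoch (b * q ^+ k) q j * qcoef q m * q ^+ m * saal_coef q u v w j *
  (1 - w * q ^+ j) * (1 - b * (q ^+ k) ^+ 2).
Proof.
move=> q0 q1 uw1 vw1 eb; have q1' := ltW q1.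
(* The order k = j + m stays fixed while j grows, so m is generalised and the induction hypothesis
   is used at m + 1. *)
rewrite {}/k; elim: j => [|j IH] in m *.
  have hm := qfactor_neq0 m q1 q1'.
  rewrite big_ord_recl big_ord0 /= !subn0 !qpoch0 saal_coef0 (qcoefS _ q1).
  by rewrite eb add0n !exprS expr0; field.
have hm := qfactor_neq0 m q1 q1'.
have hj := qfactor_neq0 j q1 q1'.
have hu := qfactor_neq0 j uw1 q1'.
have hv := qfactor_neq0 j vw1 q1'.
rewrite big_ord_recr /= addSnnS {}IH.
rewrite (_ : (j + m.+1).+1 - j.+1 = m.+1)%N; last by rewrite subSS addKn.
rewrite (_ : j + m.+1 - j.+1 = m)%N; last by rewrite addnS subSS addKn.
rewrite mulf_div_expS // saal_coefS (qcoefS _ q1).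
rewrite (qpochSl (b / q * _)) qpochS.
rewrite (_ : b / q * q ^+ (j + m.+1) * q = b * q ^+ (j + m.+1)); last by field.
move: (qpoch _ q j) (qcoef q m) (saal_coef q u v w j) => A B C.
rewrite eb exprD !exprS expr0.
move: hm hj hu hv; move: (q ^+ m) (q ^+ j) => M J hm hj hu hv.
by field; rewrite hm hj hu hv q0.
Qed.

Lemma saal_rec q b u v w k : q != 0 -> `|q| < 1 ->
    `|u * w| < 1 -> `|v * w| < 1 -> b = u * v * w ->
  (1 - q * q ^+ k) * (1 - u * w * q ^+ k) * (1 - v * w * q ^+ k) *
    bailey_sum q b (saal_coef q u v w) k.+1 =
  - q ^+ k * w * (1 - u * q ^+ k) * (1 - v * q ^+ k) *
    bailey_sum q b (saal_coef q u v w) k.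
Proof.
move=> q0 q1 uw1 vw1 eb; have q1' := ltW q1.
(* At m = 0 the partial sum exhausts the sum of order k, but misses the term i = k + 1 of the sum of
   order k + 1, which is split off below. *)
have := saal_partial k 0 q0 q1 uw1 vw1 eb.
rewrite addn0 big_split /= -!mulr_sumr -/(bailey_sum q b (saal_coef q u v w) k).
move=> /(canRL (addrK _)) H.
rewrite {1}/bailey_sum big_ord_recr /= mulrDr {}H subnn mulf_div_expS //.
rewrite qpochS saal_coefS /qcoef !qpoch0 !expr0.
have hj := qfactor_neq0 k q1 q1'.
have hu := qfactor_neq0 k uw1 q1'.
have hv := qfactor_neq0 k vw1 q1'.
move: (qpoch _ q k) (saal_coef q u v w k) (bailey_sum _ _ _ _) => A B C.
move: hj hu hv; move: (q ^+ k) => M hj hu hv.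
by rewrite eb; field; rewrite ?oner_eq0 hj hu hv.
Qed.

(** Divided by [qcoef q k], the left side is 3phi2(q^(-k), b q^(k-1), w; uw, vw; q, q), which is
    balanced because b = uvw. Both sides start at 1 and obey the same first-order recurrence. *)
Lemma bailey_sum_saal q u v w k : q != 0 -> `|q| < 1 ->
    `|u * w| < 1 -> `|v * w| < 1 ->
  bailey_sum q (u * v * w) (saal_coef q u v w) k =
  qcoef q k * w ^+ k *
  (qpoch u q k * qpoch v q k / (qpoch (u * w) q k * qpoch (v * w) q k)).
Proof.
move=> q0 q1 uw1 vw1; have q1' := ltW q1.
elim: k => [|k IH].
  rewrite /bailey_sum big_ord_recl big_ord0 /qcoef !qpoch0 saal_coef0 !expr0.
  by field; rewrite ?oner_eq0.
have hj := qfactor_neq0 k q1 q1'.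
have hu := qfactor_neq0 k uw1 q1'.
have hv := qfactor_neq0 k vw1 q1'.
have hA := qpoch_neq0 k uw1 q1'.
have hB := qpoch_neq0 k vw1 q1'.
apply: (mulfI (mulf_neq0 (mulf_neq0 hj hu) hv)).
rewrite (saal_rec k q0 q1 uw1 vw1 erefl) IH (qcoefS _ q1) !qpochS !exprS.
move: hj hu hv hA hB; move: (q ^+ k) (qpoch (u * w) q k) (qpoch (v * w) q k).
move=> Q A B hj hu hv hA hB.
by field; rewrite hj hu hv hA hB.
Qed.

(** * Terminating sums: the limit c -> 0 of Andrews' q-Watson sum *)

(** With b = s^2, (b; q^2)_n = (s, -s; q)_n, so these are the factors (q, s, -s; q)_n below the
    outer terms of the left-hand side. *)
Definition watson_coef q b n : K := (qpoch q q n * qpoch b (q ^+ 2) n)^-1.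

Lemma watson_coef0 q b : watson_coef q b 0 = 1.
Proof. by rewrite /watson_coef !qpoch0 mulr1 invr1. Qed.

Lemma watson_coefS q b n : watson_coef q b n.+1 =
  watson_coef q b n / ((1 - q * q ^+ n) * (1 - b * (q ^+ n) ^+ 2)).
Proof. by rewrite /watson_coef !qpochS exprAC !invfM; ring. Qed.

Lemma qfactor2_neq0 q b n : `|b| < 1 -> `|q| <= 1 -> 1 - b * (q ^+ n) ^+ 2 != 0.
Proof. by move=> b1 q1; rewrite exprAC qfactor_neq0 // normrX exprn_ile1. Qed.

Lemma watson_partial q b n m (N := (n + m)%N) :
    q != 0 -> `|q| < 1 -> `|b| < 1 ->
  \sum_(i < n.+1)
    ((1 - q * q * q ^+ N) * (1 - b * q ^+ N) *
       (qpoch (b / q * q ^+ N.+2) q i * qcoef q (N.+2 - i) * watson_coef q b i)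
     + b * q * (q ^+ N) ^+ 3 *
       (qpoch (b / q * q ^+ N) q i * qcoef q (N - i) * watson_coef q b i)) =
  qpoch (b * q ^+ N) q n * qcoef q m * q * (q ^+ m) ^+ 2 * watson_coef q b n
  / (1 - q * q ^+ m) * (1 - b * q * (q ^+ N) ^+ 2).
Proof.
move=> q0 q1 b1; have q1' := ltW q1.
rewrite {}/N; elim: n => [|n IH] in m *.
  have hm := qfactor_neq0 m q1 q1'.
  have hm1 := qfactor_neq0 m.+1 q1 q1'.
  rewrite big_ord_recl big_ord0 /= !subn0 !qpoch0 watson_coef0 !(qcoefS _ q1).
  rewrite add0n !exprS expr0; rewrite exprS in hm1.
  by field; rewrite hm hm1.
have hm := qfactor_neq0 m q1 q1'.
have hm1 := qfactor_neq0 m.+1 q1 q1'.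
have hn := qfactor_neq0 n q1 q1'.
have hb := qfactor2_neq0 n b1 q1'.
rewrite big_ord_recr /= addSnnS {}IH.
rewrite (_ : (n + m.+1).+2 - n.+1 = m.+2)%N; last first.
  by rewrite -addnS -addnS addnS subSS addKn.
rewrite (_ : n + m.+1 - n.+1 = m)%N; last by rewrite addnS subSS addKn.
rewrite mulf_div_expS // watson_coefS !(qcoefS _ q1).
(* The coefficient 1 - b q^N of the recurrence is the factor that links the factorial starting at b
   q^(N+1) to the one starting at b q^N. *)
have E : (1 - b * q ^+ (n + m.+1)) * qpoch (b * q ^+ (n + m.+1).+1) q n.+1 =
  qpoch (b * q ^+ (n + m.+1)) q n * (1 - b * q ^+ (n + m.+1) * q ^+ n) *
  (1 - b * q ^+ (n + m.+1) * q ^+ n.+1).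
  by rewrite exprSr mulrA -qpochSl !qpochS.
have mulr5 (k1 k2 X Y Z : K) : k1 * k2 * (X * Y * Z) = k1 * (k2 * X) * (Y * Z).
  by ring.
rewrite (mulr5 (1 - q * q * _) (1 - b * _)) {}E {mulr5}.
rewrite (qpochSl (b / q * _)) qpochS.
rewrite (_ : b / q * q ^+ (n + m.+1) * q = b * q ^+ (n + m.+1)); last by field.
move: (qpoch _ q n) (qcoef q m) (watson_coef q b n) => A B C.
move: hm1; rewrite exprD !exprS expr0.
move: hm hn hb; rewrite exprS expr1; move: (q ^+ m) (q ^+ n) => M J hm hn hb hm1.
by field; rewrite hm hn hb hm1 q0.
Qed.

Lemma watson_rec q b N : q != 0 -> `|q| < 1 -> `|b| < 1 ->
  (1 - q * q * q ^+ N) * (1 - b * q ^+ N) *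
    bailey_sum q b (watson_coef q b) N.+2 =
  - b * q * (q ^+ N) ^+ 3 * bailey_sum q b (watson_coef q b) N.
Proof.
move=> q0 q1 b1; have q1' := ltW q1.
(* At m = 0 the sum of order N is complete, while that of order N + 2 lacks its last two terms. *)
have := watson_partial N 0 q0 q1 b1.
rewrite addn0 big_split /= -!mulr_sumr -/(bailey_sum q b (watson_coef q b) N).
move=> /(canRL (addrK _)) H.
rewrite {1}/bailey_sum 2!big_ord_recr /= (mulrDr (_ * _) (_ + _)).
rewrite (mulrDr (_ * _) (\sum_(i < _) _)) {}H !mulf_div_expS //.
rewrite subnn subSnn.
have E : (1 - b * q ^+ N) * qpoch (b * q ^+ N.+1) q N.+1 =
  qpoch (b * q ^+ N) q N * (1 - b * q ^+ N * q ^+ N) *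
  (1 - b * q ^+ N * q ^+ N.+1).
  by rewrite [in LHS]exprSr mulrA -qpochSl !qpochS.
have mulr5 (k1 k2 X Y Z : K) : k1 * k2 * (X * Y * Z) = k1 * (k2 * X) * (Y * Z).
  by ring.
have mulr6 (k1 k2 X W Y Z : K) :
  k1 * k2 * (X * W * Y * Z) = k1 * (k2 * X) * (W * Y * Z) by ring.
rewrite (qpochS _ _ N.+1) (mulr5 _ _ (qpoch _ q N.+1)).
rewrite (mulr6 _ _ (qpoch _ q N.+1)) !E {E mulr5 mulr6}.
rewrite !watson_coefS !(qcoefS _ q1) /qcoef !qpoch0 bin0n /=.
have hn := qfactor_neq0 N q1 q1'.
have hn1 := qfactor_neq0 N.+1 q1 q1'.
have hb := qfactor2_neq0 N b1 q1'.
have hb1 := qfactor2_neq0 N.+1 b1 q1'.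
move: (qpoch _ q N) (watson_coef q b N) (bailey_sum _ _ _ _) => A B C.
have h1 := qfactor_neq0 0 q1 q1'.
move: hn hn1 hb hb1 h1; rewrite !exprS !expr0 !mulr1; move: (q ^+ N) => Q.
move=> hn hn1 hb hb1 h1.
by field; rewrite hn hn1 hb hb1 h1 ?oner_eq0.
Qed.

(** The sum of order 1 is -1/(1-q) + (1-b)/((1-q)(1-b)) = 0, and the two-step recurrence, whose
    leading coefficient is nonzero, propagates this. *)
Lemma bailey_sum_watson_odd q b m : q != 0 -> `|q| < 1 -> `|b| < 1 ->
  bailey_sum q b (watson_coef q b) (2 * m).+1 = 0.
Proof.
move=> q0 q1 b1; have q1' := ltW q1.
elim: m => [|m IH].
  have h1 := qfactor_neq0 0 q1 q1'; have h2 := qfactor_neq0 0 b1 q1'.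
  rewrite expr0 mulr1 in h1; rewrite expr0 mulr1 in h2.
  rewrite /bailey_sum !big_ord_recl big_ord0 /= mulf_div_expS // !qpoch0.
  rewrite !qpochS !qpoch0 watson_coefS watson_coef0 !(qcoefS _ q1) /qcoef.
  by rewrite qpoch0 !expr0 !expr1 !mulr1; field; rewrite h1 h2 ?oner_eq0.
have h1 := qfactor_neq0 (2 * m).+2 q1 q1'.
have h2 := qfactor_neq0 (2 * m).+1 b1 q1'.
have h := mulf_neq0 h1 h2.
rewrite mulnS; apply: (mulfI h); rewrite mulr0 exprS mulrA.
by rewrite (watson_rec _ q0 q1 b1) IH mulr0.
Qed.

(** Two-step recurrence from the value 1 at order 0. For b = q alpha this supplies the factors
    (-alpha)^m q^(3m^2-m) and (q; q^2)_m of the right-hand side. *)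
Lemma bailey_sum_watson_even q b m : q != 0 -> `|q| < 1 -> `|b| < 1 ->
  bailey_sum q b (watson_coef q b) (2 * m) =
  (- (b / q)) ^+ m * q ^+ (3 * m ^ 2 - m) * qpoch q (q ^+ 2) m /
  (qpoch q q (2 * m) * qpoch b (q ^+ 2) m).
Proof.
move=> q0 q1 b1; have q1' := ltW q1.
have q21 : `|q ^+ 2| <= 1 by rewrite normrX exprn_ile1.
elim: m => [|m IH].
  rewrite /bailey_sum big_ord_recl big_ord0 /= /qcoef !qpoch0 watson_coef0.
  by rewrite !expr0; field; rewrite ?oner_eq0.
have h1 := qfactor_neq0 (2 * m).+1 q1 q1'.
have h2 := qfactor_neq0 (2 * m) b1 q1'.
have h3 := qfactor_neq0 (2 * m) q1 q1'.
have hA := qpoch_neq0 m b1 q21.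
have hB := qpoch_neq0 (2 * m) q1 q1'.
rewrite exprS mulrA in h1.
rewrite mulnS; apply: (mulfI (mulf_neq0 h1 h2)).
rewrite (watson_rec _ q0 q1 b1) IH !qpochS.
(* The exponent grows by 6m + 2; the natural subtraction never truncates, as m <= 3m^2. *)
have -> : q ^+ (3 * m.+1 ^ 2 - m.+1) =
    q ^+ (3 * m ^ 2 - m) * (q ^+ (2 * m)) ^+ 3 * q ^+ 2.
  by rewrite -exprM -!exprD; congr (_ ^+ _); clear; rewrite -!mulnn; nia.
rewrite -(exprM q 2 m).
rewrite (exprS (- (b / q))).
move: h1 h2 h3; rewrite (exprS q (2 * m)).
move: hA hB; move: (qpoch b _ m) (qpoch q q (2 * m)) (q ^+ (2 * m)) (qpoch q _ m).
move: (q ^+ (3 * m ^ 2 - m)) ((- (b / q)) ^+ m) => A B C D E F hC hD h1 h2 h3.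
by field; rewrite hC hD mulrA h1 h2 h3 q0.
Qed.

End Algebra.

Section Analysis.
Variable R : realType.
Local Notation C := (R[i] : numFieldType).
Implicit Types (a b q u v w x y z M : C) (k m n : nat).

(** * Complex series with geometric majorants *)

(** A nonnegative element of the partially ordered field [R[i]] is real, so every bound and every
    epsilon can be traded for a real one. *)
Lemma nneg_complexE z : 0 <= z -> exists2 t : R, 0 <= t & z = t%:C.
Proof.
move=> z0; exists (complex.Re z); last by rewrite RRe_real ?ger0_real.
by rewrite -ler0c RRe_real ?ger0_real.
Qed.

Lemma normc_real (t : R) : `|t%:C| = `|t|%:C.
Proof. by rewrite normc_def /= expr0n addr0 sqrtr_sqr. Qed.

Lemma normc_ge_Im z : `|complex.Im z|%:C <= `|z|.
Proof.
by case: z => r s; rewrite normc_def lecR -sqrtr_sqr ler_wsqrtr // lerDr sqr_ge0.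
Qed.

Lemma cvg_real_complex (u : R^nat) (l : R) :
  u n @[n --> \oo] --> l -> ((u n)%:C : C) @[n --> \oo] --> (l%:C : C).
Proof.
move=> ul; apply/cvgrPdist_lt => e e0.
have [t t0 te] := nneg_complexE (ltW e0).
rewrite te (ltcR 0) in e0; move/cvgrPdist_lt: ul => /(_ _ e0).
apply: filterS => n; rewrite -rmorphB normc_real te.
by rewrite ltcR.
Qed.

Lemma cvg_expr_complex z : 0 <= z -> z < 1 -> z ^+ n @[n --> \oo] --> (0 : C).
Proof.
move=> /nneg_complexE[t t0 ->]; rewrite (ltcR t 1) => t1.
under eq_fun do rewrite -rmorphXn.
by apply: cvg_real_complex; apply: cvg_expr; rewrite ger0_norm.
Qed.

(** Real and imaginary parts are dominated by a real geometric series, hence converge absolutely,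
    and are then recombined. *)
Lemma is_cvg_series_geo_bound (u : C^nat) M z : 0 <= z -> z < 1 ->
  (forall n, `|u n| <= M * z ^+ n) -> cvgn (series u).
Proof.
move=> z0 z1 uM.
have M0 : 0 <= M by have := uM 0; rewrite expr0 mulr1; apply: le_trans.
have [t t0 zt] := nneg_complexE z0; have [c c0 Mc] := nneg_complexE M0.
have cv (f : C -> R) : (forall w, `|f w|%:C <= `|w|) -> cvgn (series (f \o u)).
  move=> fle; apply: normed_cvg; apply: (@series_le_cvg _ _ (geometric c t)).
  - by move=> n /=.
  - by move=> n /=; rewrite mulr_ge0 // exprn_ge0.
  - move=> n /=; rewrite -lecR; apply: le_trans (fle _) _.
    by apply: le_trans (uM n) _; rewrite zt Mc -rmorphXn -rmorphM.
  - apply: is_cvg_geometric_series; rewrite ger0_norm //.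
    by rewrite -(ltcR t 1) -zt.
have hRe := cvg_real_complex (cv (@complex.Re R) (@normc_ge_Re R)).
have hIm := cvg_real_complex (cv (@complex.Im R) normc_ge_Im).
have -> : series u = fun n => (series (@complex.Re R \o u) n)%:C +
    'i%C * (series (@complex.Im R \o u) n)%:C.
  apply/funext => n; rewrite !seriesEnat /= !rmorph_sum mulr_sumr -big_split /=.
  by apply: eq_bigr => i _; rewrite -complexE.
apply: is_cvgD; first exact: cvgP hRe.
by apply: is_cvgM; [exact: is_cvg_cst | exact: cvgP hIm].
Qed.

Lemma sum_geo_le z m n : 0 <= z -> z < 1 ->
  \sum_(m <= k < n) z ^+ k <= z ^+ m / (1 - z).
Proof.
move=> z0 z1; have z1' : 0 < 1 - z by rewrite subr_gt0.
have [nm|mn] := leqP n m.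
  by rewrite big_geq // divr_ge0 ?exprn_ge0 // ltW.
rewrite ler_pdivlMr // mulr_suml.
under eq_bigr do rewrite mulrBr mulr1 -exprSr -opprB.
rewrite sumrN telescope_sumr ?(ltnW mn) // opprB lerBlDr lerDl.
exact: exprn_ge0.
Qed.

Lemma series_tail_le (u : C^nat) l M z n : 0 <= z -> z < 1 ->
  (forall n, `|u n| <= M * z ^+ n) -> series u @ \oo --> l ->
  `|l - series u n| <= M * (z ^+ n / (1 - z)).
Proof.
move=> z0 z1 uM ul.
have M0 : 0 <= M by have := uM 0; rewrite expr0 mulr1; apply: le_trans.
apply/ler_addgt0Pr => e e0.
move/cvgrPdist_lt: ul => /(_ _ e0) ul.
near \oo => m.
have nm : (n <= m)%N by near: m; exact: nbhs_infty_ge.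
rewrite -(subrK (series u m) l) -addrA addrC.
apply: le_trans (ler_normD _ _) _; apply: lerD; last first.
  by apply: ltW; near: m.
rewrite sub_series_geq //; apply: le_trans (ler_norm_sum _ _ _) _.
apply: le_trans (_ : \sum_(n <= k < m) M * z ^+ k <= _).
  by apply: ler_sum => i _.
by rewrite -mulr_sumr ler_wpM2l // sum_geo_le.
Unshelve. all: by end_near. Qed.

Lemma cvg_geo_bound M z : 0 <= z -> z < 1 ->
  M * z ^+ n @[n --> \oo] --> (0 : C).
Proof.
move=> z0 z1; rewrite -[X in _ --> X](mulr0 M).
by apply: cvgM; [exact: cvg_cst | exact: cvg_expr_complex].
Qed.

(** Dominated convergence for series: the majorant makes the tails small uniformly in m, and the
    remaining finite sum converges termwise. *)
Lemma tannery (f : nat -> nat -> C) (g s : C^nat) M z : 0 <= z -> z < 1 ->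
  (forall m n, `|f m n| <= M * z ^+ n) ->
  (forall n, f m n @[m --> \oo] --> g n) ->
  (forall m, series (f m) @ \oo --> s m) ->
  exists2 l : C, series g @ \oo --> l & (s : C^nat) @ \oo --> l.
Proof.
move=> z0 z1 fM fg fs.
have gM n : `|g n| <= M * z ^+ n.
  apply/ler_addgt0Pr => e e0; have /cvgrPdist_lt/(_ _ e0) h := fg n.
  near \oo => m.
  rewrite -(subrK (f m n) (g n)) addrC.
  apply: le_trans (ler_normD _ _) _; apply: lerD => //.
  by apply: ltW; near: m.
have gl := is_cvg_series_geo_bound z0 z1 gM.
exists (limn (series g)) => //; set l := limn _.
apply/cvgrPdist_lt => e e0.
have e3 : 0 < e / 3 by rewrite divr_gt0.
have z1' : 0 < 1 - z by rewrite subr_gt0.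
have tail0 : M * (z ^+ n / (1 - z)) @[n --> \oo] --> (0 : C).
  under eq_fun do rewrite mulrA mulrAC; exact: cvg_geo_bound.
have M0 : 0 <= M by have := gM 0; rewrite expr0 mulr1; apply: le_trans.
have [N _ /(_ N (leqnn N))] : \forall n \near \oo, M * (z ^+ n / (1 - z)) < e / 3.
  move/cvgrPdist_lt: tail0 => /(_ _ e3); apply: filterS => n.
  rewrite sub0r normrN ger0_norm //.
  by rewrite mulr_ge0 // divr_ge0 ?exprn_ge0 // ltW.
move=> /= HN.
have /cvgrPdist_lt/(_ _ e3) H : series (f m) N @[m --> \oo] --> series g N.
  rewrite seriesEord; under eq_fun do rewrite seriesEord.
  by apply: cvg_big => [|i _]; [exact: add_continuous | exact: fg].
apply: filterS H => m H.
have -> : l - s m = (l - series g N) + (series g N - series (f m) N)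
   - (s m - series (f m) N) by ring.
apply: le_lt_trans (ler_normB _ _) _.
apply: le_lt_trans (lerD (ler_normD _ _) (lexx _)) _.
have -> : e = e / 3 + e / 3 + e / 3 by field.
apply: ltr_leD; first apply: ltr_leD.
- exact: le_lt_trans (series_tail_le _ z0 z1 gM gl) HN.
- exact: ltW.
- exact: ltW (le_lt_trans (series_tail_le _ z0 z1 (fM m) (fs m)) HN).
Unshelve. all: by end_near. Qed.

(** * Uniform bounds for q-shifted factorials *)

(** From 1 + t <= exp t, the product is at most exp(x / (1 - |q|)), a bound independent of [f] and
    [n]. *)
Lemma prod_geo_bound q x : `|q| < 1 -> 0 <= x -> exists M : C,
  forall (f : C^nat) n, (forall k, `|f k| <= 1 + x * `|q| ^+ k) ->
  `|\prod_(k < n) f k| <= M.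
Proof.
move=> q1 /nneg_complexE[t t0 xt].
have [p p0 qp] := nneg_complexE (normr_ge0 q).
exists (expR (t / (1 - p)))%:C => f n fle.
apply: le_trans (_ : (expR (t * \sum_(0 <= k < n) p ^+ k))%:C <= _).
  elim: n => [|n IH].
    by rewrite big_ord0 big_nil mulr0 expR0 normr1.
  rewrite big_ord_recr big_nat_recr //= mulrDr expRD rmorphM normrM.
  apply: ler_pM => //; apply: le_trans (fle n) _.
  by rewrite xt qp -rmorphXn -rmorphM -(rmorphD _ 1) lecR expR_ge1Dx.
rewrite lecR ler_expR ler_wpM2l // -lecR.
have -> : (\sum_(0 <= k < n) p ^+ k)%:C = \sum_(0 <= k < n) `|q| ^+ k :> C.
  by rewrite rmorph_sum; apply: eq_bigr => k _; rewrite qp rmorphXn.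
apply: le_trans (sum_geo_le _ _ (normr_ge0 q) q1) _.
by rewrite expr0 mul1r fmorphV rmorphB qp.
Qed.

Lemma qpoch_bound q x : `|q| < 1 -> 0 <= x -> exists M : C,
  forall a n, `|a| <= x -> `|qpoch a q n| <= M.
Proof.
move=> q1 x0; have [M HM] := prod_geo_bound q1 x0.
exists M => a n ax; apply: (HM (fun k => 1 - a * q ^+ k)) => k.
apply: le_trans (ler_normB _ _) _; rewrite normr1 lerD2l normrM normrX.
by rewrite ler_wpM2r // exprn_ge0.
Qed.

(** With t = x |q|^k <= x, each inverse factor is at most 1/(1-t) <= 1 + t/(1-x), which is the form
    required by [prod_geo_bound]. *)
Lemma qpoch_inv_bound q x : `|q| < 1 -> 0 <= x -> x < 1 -> exists M : C,
  forall a n, `|a| <= x -> `|(qpoch a q n)^-1| <= M.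
Proof.
move=> q1 x0 x1; have x1' : 0 < 1 - x by rewrite subr_gt0.
have [M HM] := prod_geo_bound q1 (divr_ge0 x0 (ltW x1')).
exists M => a n ax; rewrite /qpoch -prodfV.
apply: (HM (fun k => (1 - a * q ^+ k)^-1)) => k.
have q0 : 0 <= `|q| ^+ k by rewrite exprn_ge0.
have q1k : `|q| ^+ k <= 1 by rewrite exprn_ile1 // ltW.
have le1 : x * `|q| ^+ k <= x by rewrite ler_piMr.
have pos : 0 < 1 - x * `|q| ^+ k by rewrite subr_gt0 (le_lt_trans le1).
have le2 : 1 - x * `|q| ^+ k <= `|1 - a * q ^+ k|.
  apply: le_trans (lerB_dist _ _); rewrite normr1 lerD2l lerN2 normrM normrX.
  by rewrite ler_wpM2r.
rewrite normfV.
apply: le_trans (_ : (1 - x * `|q| ^+ k)^-1 <= _).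
  by rewrite lef_pV2 ?posrE // (lt_le_trans pos).
rewrite -[leLHS]mul1r ler_pdivrMr // -subr_ge0.
set t := x * `|q| ^+ k in le1 pos *.
have -> : (1 + x / (1 - x) * `|q| ^+ k) * (1 - t) - 1 =
  t * ((x - t) / (1 - x)) by rewrite /t; field; rewrite gt_eqF.
by rewrite !mulr_ge0 // ?invr_ge0 ?subr_ge0 // ltW.
Qed.

Definition bnd (u : C^nat) := exists M : C, forall n, `|u n| <= M.

Lemma bndM (u v : C^nat) : bnd u -> bnd v -> bnd (fun n => u n * v n).
Proof.
by move=> [M HM] [N HN]; exists (M * N) => n; rewrite normrM ler_pM.
Qed.

Lemma bnd_qpoch a q : `|q| < 1 -> bnd (qpoch a q).
Proof.
by move=> q1; have [M HM] := qpoch_bound q1 (normr_ge0 a); exists M => n; exact: HM.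
Qed.

Lemma bnd_qpochV a q : `|q| < 1 -> `|a| < 1 -> bnd (fun n => (qpoch a q n)^-1).
Proof.
move=> q1 a1; have [M HM] := qpoch_inv_bound q1 (normr_ge0 a) a1.
by exists M => n; exact: HM.
Qed.

Lemma bnd_qcoef q : `|q| < 1 -> bnd (qcoef q).
Proof.
move=> q1; apply: bndM (bnd_qpochV q1 q1); exists 1 => n.
by rewrite normrM !normrX normrN normr1 expr1n mul1r exprn_ile1 // ltW.
Qed.

Lemma vwfac_bound q x : `|q| < 1 -> 0 <= x -> exists M : C,
  forall b n, `|b| <= x -> `|vwfac q b n| <= M.
Proof.
move=> q1 x0; have [M HM] := qpoch_bound q1 x0.
have M0 : 0 <= M by apply: le_trans (HM 0 0 _); rewrite ?normr0.
exists (1 + (1 + x) * M) => b [|n] bx /=.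
  by rewrite normr1 lerDl mulr_ge0 // addr_ge0.
rewrite normrM -[leLHS]add0r; apply: lerD => //; apply: ler_pM; rewrite ?HM //.
apply: le_trans (ler_normB _ _) _; rewrite normr1 lerD2l normrM normrX.
by apply: le_trans bx; rewrite ler_piMr // exprn_ile1 // ltW.
Qed.

Lemma bnd_vwfac q b : `|q| < 1 -> bnd (vwfac q b).
Proof.
by move=> q1; have [M HM] := vwfac_bound q1 (normr_ge0 b); exists M => n; exact: HM.
Qed.

(** * Infinite q-shifted factorials *)

(** The increments -a q^k (a; q)_k are geometrically small since the factorials are bounded, so the
    partial products form a convergent series. *)
Lemma cvg_qpoch a q : `|q| < 1 -> qpoch a q @ \oo --> qpoch_inf a q.
Proof.
move=> q1; have [M HM] := bnd_qpoch a q1; rewrite /qpoch_inf.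
have -> : qpoch a q =
    fun n => 1 + series (fun k => - (a * q ^+ k) * qpoch a q k) n.
  apply/funext => n; rewrite seriesEord /=; elim: n => [|n IH].
    by rewrite qpoch0 big_ord0 addr0.
  by rewrite qpochS big_ord_recr /= addrA -IH; ring.
apply: is_cvgD; first exact: is_cvg_cst.
apply: (@is_cvg_series_geo_bound _ (`|a| * M) `|q|) => // n.
rewrite normrM normrN normrM normrX [leRHS]mulrAC ler_wpM2l //.
exact: HM.
Qed.

Lemma qpoch_infD a q n : `|q| < 1 ->
  qpoch_inf a q = qpoch a q n * qpoch_inf (a * q ^+ n) q.
Proof.
move=> q1; apply: cvg_lim; first exact: norm_hausdorff.
rewrite -(cvg_shiftn n); under eq_fun do rewrite addnC qpochD.
by apply: cvgM; [exact: cvg_cst | exact: cvg_qpoch].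
Qed.

(** The inverses of the partial products are bounded, so the partial products cannot tend to 0. *)
Lemma qpoch_inf_neq0 a q : `|q| < 1 -> `|a| < 1 -> qpoch_inf a q != 0.
Proof.
move=> q1 a1; apply/eqP => E.
have [M HM] := bnd_qpochV q1 a1.
have M0 : 0 <= M by apply: le_trans (HM 0).
have := @cvg_qpoch a q q1; rewrite E => /cvgrPdist_lt.
have M1 : 0 < (M + 1)^-1 by rewrite invr_gt0 ltr_wpDl.
move=> /(_ _ M1) [n _ /(_ n (leqnn n))] /=; rewrite sub0r normrN => H.
have : `|qpoch a q n * (qpoch a q n)^-1| < 1.
  rewrite normrM; apply: le_lt_trans (ler_wpM2l _ (HM n)) _ => //.
  apply: le_lt_trans (_ : (M + 1)^-1 * M < 1); first by rewrite ler_wpM2r // ltW.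
  by rewrite mulrC ltr_pdivrMr ?mul1r ?ltrDl // ltr_wpDl.
by rewrite divff ?normr1 ?ltxx // qpoch_neq0 // ltW.
Qed.

Lemma cvgC_unique (u : C^nat) (l l' : C) :
  u @ \oo --> l -> u @ \oo --> l' -> l = l'.
Proof. by do 2!move=> /(cvg_lim (@norm_hausdorff _ _)) <-. Qed.

(** * The limiting 6phi5 sum *)

(** Uniformity in [w] is what allows the passage to the limit along w = z q^n. *)
Lemma phi65_term_bound q x y z :
  `|q| < 1 -> `|z| < 1 -> `|x * z| < 1 -> `|y * z| < 1 -> exists M : C,
  forall w k, `|w| <= `|z| -> `|phi65_term q x y w k| <= M * `|w| ^+ k.
Proof.
move=> q1 z1 xz1 yz1.
have [M1 H1] := vwfac_bound q1 (normr_ge0 (x * y * z)).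
have [M2 H2] := bndM (bnd_qcoef q1) (bndM (bnd_qpoch x q1) (bnd_qpoch y q1)).
have [M3 H3] := qpoch_inv_bound q1 (normr_ge0 _) xz1.
have [M4 H4] := qpoch_inv_bound q1 (normr_ge0 _) yz1.
exists (M1 * M2 * (M3 * M4)) => w k wz.
have -> : phi65_term q x y w k = vwfac q (x * y * w) k *
  (qcoef q k * (qpoch x q k * qpoch y q k)) *
  ((qpoch (x * w) q k)^-1 * (qpoch (y * w) q k)^-1) * w ^+ k.
  by rewrite /phi65_term invfM; ring.
rewrite normrM normrX ler_wpM2r ?exprn_ge0 //.
have le a : `|a * w| <= `|a * z| by rewrite !normrM ler_wpM2l.
rewrite normrM (normrM (vwfac _ _ _)) (normrM (qpoch (x * w) q k)^-1).
apply: ler_pM; rewrite ?mulr_ge0 //; apply: ler_pM => //.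
- exact: H1 (le _).
- exact: H2.
- exact: H3 (le _).
- exact: H4 (le _).
Qed.

Lemma is_cvg_phi65 q x y z :
  `|q| < 1 -> `|z| < 1 -> `|x * z| < 1 -> `|y * z| < 1 ->
  cvgn (series (phi65_term q x y z)).
Proof.
move=> q1 z1 xz1 yz1; have [M HM] := phi65_term_bound q1 z1 xz1 yz1.
by apply: (is_cvg_series_geo_bound (normr_ge0 z) z1) => k; exact: HM.
Qed.

Lemma normr_mulX_lt1 q x n : `|q| < 1 -> `|x| < 1 -> `|x * q ^+ n| < 1.
Proof.
move=> q1 x1; rewrite normrM normrX; apply: le_lt_trans x1.
by rewrite ler_piMr // exprn_ile1 // ltW.
Qed.

(** Limit of [phi65_telescope]: the telescoped remainder is a bounded sequence times z^(n+1). *)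
Lemma phi65_rec q x y z (F := fun t => limn (series (phi65_term q x y t))) :
  `|q| < 1 -> `|z| < 1 -> `|x * z| < 1 -> `|y * z| < 1 ->
  (1 - y * z) * (1 - x * z) * F z = (1 - x * y * z) * (1 - z) * F (z * q).
Proof.
move=> q1 z1 xz1 yz1.
have mq a : `|a| < 1 -> `|a * q| < 1.
  by rewrite -{1}(expr1 q); exact: normr_mulX_lt1.
apply/eqP; rewrite -subr_eq0; apply/eqP.
have cF t : `|t| < 1 -> `|x * t| < 1 -> `|y * t| < 1 ->
    series (phi65_term q x y t) @ \oo --> F t.
  by move=> *; exact: is_cvg_phi65.
have cz := cF z z1 xz1 yz1.
have czq : series (phi65_term q x y (z * q)) @ \oo --> F (z * q).
  by apply: cF; rewrite ?mulrA; exact: mq.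
set u : C^nat := fun n => (1 - y * z) * (1 - x * z) * series (phi65_term q x y z) n
  - (1 - x * y * z) * (1 - z) * series (phi65_term q x y (z * q)) n.
apply: (@cvgC_unique u).
  exact: (cvgB (cvgM (cvg_cst _) cz) (cvgM (cvg_cst _) czq)).
rewrite -cvg_shiftS.
have [M HM] : bnd (fun n => qpoch (x * y * z) q n * qcoef q n * q ^+ n *
  (qpoch x q n.+1 * qpoch y q n.+1) *
  ((qpoch (x * z * q) q n)^-1 * (qpoch (y * z * q) q n)^-1)).
  have bS a : bnd (fun n => qpoch a q n.+1).
    by have [M HM] := bnd_qpoch a q1; exists M => n.
  apply: bndM; last by apply: bndM; apply: bnd_qpochV => //; exact: mq.
  apply: bndM; last exact: bndM.
  apply: bndM; last first.
    by exists 1 => n; rewrite normrX exprn_ile1 // ltW.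
  by apply: bndM; [exact: bnd_qpoch | exact: bnd_qcoef].
have lim0 : (M * `|z|) * `|z| ^+ n @[n --> \oo] --> (0 : C).
  exact: cvg_geo_bound.
apply/cvgrPdist_lt => e e0; move/cvgrPdist_lt: lim0 => /(_ e e0).
apply: filterS => n; rewrite !sub0r !normrN => H; apply: le_lt_trans H.
rewrite /u !seriesEord /= 2!mulr_sumr -sumrB.
rewrite (phi65_telescope n q1 xz1 yz1) [leRHS]ger0_norm; last first.
  by rewrite !mulr_ge0 ?exprn_ge0 //; apply: le_trans (HM 0).
rewrite -[leRHS]mulrA -exprS -normrX; apply: le_trans (ler_wpM2r (normr_ge0 _) (HM n)).
by rewrite -normrM invfM le_eqVlt; apply/orP; left; apply/eqP; congr `|_|; ring.
Qed.

(* The limiting case f -> oo of the nonterminating 6phi5 summation. *)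
Lemma phi65_sum q x y z :
  `|q| < 1 -> `|z| < 1 -> `|x * z| < 1 -> `|y * z| < 1 ->
  series (phi65_term q x y z) @ \oo -->
  qpoch_inf (x * y * z) q * qpoch_inf z q /
  (qpoch_inf (x * z) q * qpoch_inf (y * z) q).
Proof.
move=> q1 z1 xz1 yz1.
(* The existential keeps [F] opaque during the rewriting. *)
have [F FE] : exists F : C -> C, F = fun t => limn (series (phi65_term q x y t)).
  by eexists.
have cz : series (phi65_term q x y z) @ \oo --> F z.
  by rewrite FE; exact: is_cvg_phi65.
suff -> : qpoch_inf (x * y * z) q * qpoch_inf z q /
  (qpoch_inf (x * z) q * qpoch_inf (y * z) q) = F z by [].
have hx := qpoch_inf_neq0 q1 xz1; have hy := qpoch_inf_neq0 q1 yz1.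
have hxy := mulf_neq0 hx hy.
apply: (canLR (mulfK hxy)).
have step (P1 P2 Q1 Q2 s t s' t' F0 F1 F2 : C) :
    P1 * P2 * F0 = F2 * (Q1 * Q2) -> t' * s' * F0 = s * t * F1 ->
    P1 * s * (P2 * t) * F1 = F2 * (Q1 * s' * (Q2 * t')).
  move=> H1 H2; transitivity (P1 * P2 * (s * t * F1)); first by ring.
  by rewrite -H2 mulrCA H1; ring.
(* The q-difference equation iterated n times; letting n -> oo gives the sum once F(z q^n) -> 1. *)
have Fn n : qpoch (x * y * z) q n * qpoch z q n * F (z * q ^+ n) =
    F z * (qpoch (x * z) q n * qpoch (y * z) q n).
  elim: n => [|n IH]; first by rewrite !qpoch0 expr0 !mulr1 mul1r.
  rewrite !qpochS exprSr (mulrA z); apply: (step _ _ _ _ _ _ _ _ _ _ _ IH).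
  have := @phi65_rec q x y (z * q ^+ n) q1; rewrite !mulrA FE; apply.
  - exact: normr_mulX_lt1.
  - exact: normr_mulX_lt1.
  - exact: normr_mulX_lt1.
(* The term k = 0 is 1, and the tail from k = 1 on is O(|z q^n|). *)
have F1 : F (z * q ^+ n) @[n --> \oo] --> (1 : C).
  have [M HM] := phi65_term_bound q1 z1 xz1 yz1.
  have z1' : 0 < 1 - `|z| by rewrite subr_gt0.
  have lim0 : (M * `|z| / (1 - `|z|)) * `|q| ^+ n @[n --> \oo] --> (0 : C).
    exact: cvg_geo_bound.
  apply/cvgrPdist_lt => e e0; move/cvgrPdist_lt: lim0 => /(_ e e0).
  apply: filterS => n; rewrite !sub0r !normrN => H.
  have le n' : `|z * q ^+ n'| <= `|z|.
    by rewrite normrM normrX ler_piMr // exprn_ile1 // ltW.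
  have M0 : 0 <= M.
    by have := HM z 0 (lexx _); rewrite expr0 mulr1; apply: le_trans.
  rewrite -normrN opprB; apply: le_lt_trans H; rewrite [leRHS]ger0_norm; last first.
    by rewrite !mulr_ge0 ?invr_ge0 ?exprn_ge0 // ltW.
  have T : series (phi65_term q x y (z * q ^+ n)) @ \oo --> F (z * q ^+ n).
    by rewrite FE; apply: is_cvg_phi65; rewrite ?mulrA ?normr_mulX_lt1.
  have := series_tail_le 1 (normr_ge0 _) (normr_mulX_lt1 n q1 z1)
    (fun k => HM _ k (le n)) T.
  rewrite seriesEord /= big_ord1 /phi65_term /qcoef !qpoch0 !expr0 /= !mulr1.
  rewrite !divr1 !mulr1 => h; apply: le_trans h _.
  rewrite normrM normrX expr1 -!mulrA ler_wpM2l // ler_wpM2l //.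
  rewrite [leRHS]mulrC ler_wpM2l ?exprn_ge0 // lef_pV2 ?posrE //.
    by rewrite lerD2l lerN2 -normrX -normrM.
  by rewrite -normrX -normrM subr_gt0 normr_mulX_lt1.
have c1 : qpoch (x * y * z) q n * qpoch z q n * F (z * q ^+ n) @[n --> \oo] -->
    qpoch_inf (x * y * z) q * qpoch_inf z q * 1.
  by apply: cvgM F1; apply: cvgM; exact: cvg_qpoch.
rewrite mulr1 in c1; apply: (cvgC_unique c1).
under eq_fun do rewrite Fn.
by apply: cvgM; [exact: cvg_cst | apply: cvgM; exact: cvg_qpoch].
Qed.

(** * Exchange of summation in the double series *)

Lemma cvg_series_finite (u : C^nat) n :
  (forall k, (n <= k)%N -> u k = 0) -> series u @ \oo --> series u n.
Proof.
move=> u0; rewrite -(cvg_shiftn n).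
rewrite (_ : [sequence _]_m = cst (series u n)); first exact: cvg_cst.
apply/funext => m /=; apply/eqP; rewrite -subr_eq0 sub_series_geq ?leq_addl //.
by rewrite big_nat_cond big1 // => i /andP[/andP[/u0]].
Qed.

Lemma sum_triangle (V : nmodType) (f : nat -> nat -> V) m :
  \sum_(i < m) \sum_(j < m - i) f i j = \sum_(k < m) \sum_(i < k.+1) f i (k - i)%N.
Proof.
elim: m => [|m IH]; first by rewrite !big_ord0.
rewrite [RHS]big_ord_recr /= -IH [in RHS]big_ord_recr /= subnn addrA.
rewrite -big_split [LHS]big_ord_recr /= subSnn big_ord1; congr (_ + _).
by apply: eq_bigr => i _; rewrite subSn ?big_ord_recr // ltnW.
Qed.

(** The first series sums the double array [A n k] by rows, the second along the diagonals n + k =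
    N. Both are limits of the same triangular partial sums: by [tannery] for the rows, by reindexing
    for the diagonals. *)
Lemma bailey q b (g h L : C^nat) M z : q != 0 -> `|q| < 1 -> 0 <= z -> z < 1 ->
  (forall n, `|g n| <= M * z ^+ n) -> bnd h ->
  (forall n, series (fun k => vwfac q (b * q ^+ (2 * n)) k * qcoef q k * g (n + k)%N)
     @ \oo --> L n) ->
  exists2 l : C,
    series (fun n => qpoch b q (2 * n) * h n * L n) @ \oo --> l &
    series (fun n => vwfac q b n * g n * bailey_sum q b h n) @ \oo --> l.
Proof.
move=> q0 q1 z0 z1 gM [M5 H5] gL.
have [M1 H1] := bnd_vwfac b q1; have [M3 H3] := bnd_qcoef q1.
have [M2 H2] := qpoch_bound q1 (normr_ge0 (b / q)).
pose A n k := vwfac q b (n + k) * g (n + k)%N *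
  (qpoch (b / q * q ^+ (n + k)) q n * qcoef q k * h n).
have M00 (u : C^nat) (N : C) : (forall n, `|u n| <= N) -> 0 <= N.
  by move=> /(_ 0); apply: le_trans.
have N2 n k : `|qpoch (b / q * q ^+ n) q k| <= M2.
  by apply: H2; rewrite normrM normrX ler_piMr // exprn_ile1 // ltW.
have M1p := M00 _ _ H1; have M3p := M00 _ _ H3; have M5p := M00 _ _ H5.
have M2p : 0 <= M2 by apply: le_trans (N2 0 0).
have Mp : 0 <= M by have := gM 0; rewrite expr0 mulr1; apply: le_trans.
pose D := M1 * M * (M2 * M3 * M5).
have AD n k : `|A n k| <= D * z ^+ (n + k).
  have -> : D * z ^+ (n + k) = M1 * (M * z ^+ (n + k)) * (M2 * M3 * M5).
    by rewrite /D; ring.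
  rewrite /A normrM (normrM (vwfac _ _ _)) (normrM (_ * _) (h n)).
  rewrite (normrM (qpoch _ _ _)).
  apply: ler_pM; rewrite ?mulr_ge0 //; first exact: ler_pM.
  apply: ler_pM; rewrite ?mulr_ge0 //.
  by apply: ler_pM; rewrite ?N2 ?H3.
(* Row n cut to the triangle n + k < m; for n >= m truncated subtraction makes it empty, so [s m] is
   the sum of the whole series of [f m]. *)
pose f m n := \sum_(k < m - n) A n k.
pose s m := \sum_(n < m) f m n.
have z1' : 0 < 1 - z by rewrite subr_gt0.
have fE n N : \sum_(k < N) A n k = qpoch b q (2 * n) * h n *
    series (fun k => vwfac q (b * q ^+ (2 * n)) k * qcoef q k * g (n + k)%N) N.
  rewrite seriesEord /= mulr_sumr; apply: eq_bigr => k _.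
  transitivity (qpoch b q (2 * n) * vwfac q (b * q ^+ (2 * n)) k *
    (h n * qcoef q k * g (n + k)%N)); last by ring.
  by rewrite vwfac_shift // /A; ring.
have [||| l Hl sl] := @tannery f (fun n => qpoch b q (2 * n) * h n * L n) s
   (D / (1 - z)) z z0 z1.
- move=> m n; apply: le_trans (ler_norm_sum _ _ _) _.
  apply: le_trans (_ : \sum_(0 <= k < m - n) D * z ^+ n * z ^+ k <= _).
    by rewrite big_mkord; apply: ler_sum => i _; rewrite -mulrA -exprD AD.
  rewrite -mulr_sumr [leRHS]mulrAC; apply: ler_wpM2l.
    by rewrite !mulr_ge0 // exprn_ge0.
  by apply: le_trans (sum_geo_le _ _ z0 z1) _; rewrite expr0 mul1r.
- move=> n; under eq_fun do rewrite /f fE.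
  apply: cvgM; first exact: cvg_cst.
  exact: cvg_comp (@cvg_subnr n) (gL n).
- move=> m; have -> : s m = series (f m) m by rewrite seriesEord.
  apply: cvg_series_finite => k mk.
  by rewrite /f (eqP (_ : (m - k)%N == 0)) ?big_ord0 // subn_eq0.
exists l => //.
suff -> : series (fun n => vwfac q b n * g n * bailey_sum q b h n) = s by [].
apply/funext => m; rewrite /s /f sum_triangle seriesEord /=.
apply: eq_bigr => N _; rewrite /bailey_sum mulr_sumr; apply: eq_bigr => n _.
by rewrite /A subnKC // -ltnS.
Qed.

(** * 3phi2 series and the limit of Watson's transformation *)

Lemma phi32_termE a1 a2 a3 b1 b2 q z n : phi32_term a1 a2 a3 b1 b2 q z n =
  qpoch a1 q n * qpoch a2 q n * qpoch a3 q n /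
  (qpoch q q n * qpoch b1 q n * qpoch b2 q n) * z ^+ n.
Proof. by rewrite /phi32_term /qpochs !big_cons !big_nil !mulr1 !mulrA. Qed.

Lemma is_cvg_phi32 a1 a2 a3 b1 b2 q z :
  `|q| < 1 -> `|b1| < 1 -> `|b2| < 1 -> `|z| < 1 ->
  cvgn (series (phi32_term a1 a2 a3 b1 b2 q z)).
Proof.
move=> q1 b11 b21 z1.
have [M HM] : bnd (fun n => qpoch a1 q n * qpoch a2 q n * qpoch a3 q n *
  ((qpoch q q n)^-1 * (qpoch b1 q n)^-1 * (qpoch b2 q n)^-1)).
  by do ![apply: bndM]; try exact: bnd_qpoch; exact: bnd_qpochV.
apply: (@is_cvg_series_geo_bound _ M _ (normr_ge0 z) z1) => n.
rewrite phi32_termE.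
rewrite normrM normrX ler_wpM2r ?exprn_ge0 // !invfM.
exact: HM.
Qed.

Lemma cvg_seriesZ (c l : C) (u v : C^nat) : (forall n, v n = c * u n) ->
  series u @ \oo --> l -> series v @ \oo --> c * l.
Proof.
move=> E ul; rewrite (_ : series v = fun n => c * series u n).
  by apply: cvgM; first exact: cvg_cst.
by apply/funext => n; rewrite !seriesEord /= mulr_sumr; apply: eq_bigr.
Qed.

(** The balanced-looking data of an 8phi7 with xyz = uvw = alpha q: the lower parameters are alpha q
    divided by u, v, x, y up to order, and alpha^2 q^2/(xyuv) = wz is the argument left by f ->
    oo. *)
Definition wp_coef q x y z u v w n : C :=
  qpoch x q n * qpoch y q n * qpoch u q n * qpoch v q n /
  (qpoch (u * w) q n * qpoch (v * w) q n * qpoch (x * z) q n * qpoch (y * z) q n)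
  * (w * z) ^+ n.

(* Nonterminating limit f -> oo of Watson's transformation of a
   very-well-poised 8phi7 into a balanced 4phi3. *)
Lemma watson_phi32 q x y z u v w : q != 0 -> `|q| < 1 -> `|z| < 1 ->
  `|x * z| < 1 -> `|y * z| < 1 -> `|u * w| < 1 -> `|v * w| < 1 ->
  x * y * z = u * v * w ->
  series (fun n => vwfac q (x * y * z) n * qcoef q n * wp_coef q x y z u v w n)
    @ \oo -->
  qpoch_inf (x * y * z) q * qpoch_inf z q /
    (qpoch_inf (x * z) q * qpoch_inf (y * z) q) *
    phi32 x y w (u * w) (v * w) q z.
Proof.
move=> q0 q1 z1 xz1 yz1 uw1 vw1 e.
(* This [g] makes the rows limiting 6phi5 sums, and [saal_coef] as [h] makes the diagonals
   q-Pfaff-Saalschuetz sums. *)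
pose g n := qpoch x q n * qpoch y q n /
  (qpoch (x * z) q n * qpoch (y * z) q n) * z ^+ n.
set P := qpoch_inf _ q * _ / _.
pose Q n := qpoch_inf (x * y * z * q ^+ (2 * n)) q * qpoch_inf z q /
  (qpoch_inf (x * z * q ^+ n) q * qpoch_inf (y * z * q ^+ n) q).
have [M HM] : bnd (fun n => qpoch x q n * qpoch y q n *
    ((qpoch (x * z) q n)^-1 * (qpoch (y * z) q n)^-1)).
  by do ![apply: bndM]; try exact: bnd_qpoch; exact: bnd_qpochV.
have gM n : `|g n| <= M * `|z| ^+ n.
  by rewrite /g normrM normrX ler_wpM2r ?exprn_ge0 // invfM HM.
have hM : bnd (saal_coef q u v w).
  have [N HN] : bnd (fun n => qpoch w q n *
    ((qpoch q q n)^-1 * (qpoch (u * w) q n)^-1 * (qpoch (v * w) q n)^-1)).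
    by do ![apply: bndM]; try exact: bnd_qpoch; exact: bnd_qpochV.
  by exists N => n; rewrite /saal_coef !invfM HN.
have gL n : series (fun k => vwfac q (x * y * z * q ^+ (2 * n)) k * qcoef q k *
    g (n + k)%N) @ \oo --> g n * Q n.
  have := @phi65_sum q (x * q ^+ n) (y * q ^+ n) z q1 z1.
  rewrite !(mulrAC _ (q ^+ n) z) (_ : x * q ^+ n * (y * q ^+ n) * z =
    x * y * z * q ^+ (2 * n)); last by rewrite mul2n -addnn exprD; ring.
  rewrite -/(Q n) => H.
  have {}H := H (normr_mulX_lt1 n q1 xz1) (normr_mulX_lt1 n q1 yz1).
  apply: cvg_seriesZ H => k.
  rewrite /phi65_term /g !(mulrAC _ (q ^+ n) z) !qpochD exprD.
  rewrite (_ : x * q ^+ n * (y * q ^+ n) * z =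
    x * y * z * q ^+ (2 * n)); last by rewrite mul2n -addnn exprD; ring.
  by rewrite !invfM; ring.
have [l Hl] := bailey q0 q1 (normr_ge0 z) z1 gM hM gL.
rewrite (_ : (fun n => _ * bailey_sum _ _ _ _) =
  fun n => vwfac q (x * y * z) n * qcoef q n * wp_coef q x y z u v w n); last first.
  apply/funext => n; rewrite e bailey_sum_saal // /g /wp_coef exprMn !invfM.
  by ring.
suff -> : l = P * phi32 x y w (u * w) (v * w) q z by [].
apply: (cvgC_unique Hl).
have cv := @is_cvg_phi32 x y w (u * w) (v * w) q z q1 uw1 vw1 z1.
(* (b; q)_(2n) and the finite factorials in [g n] complete the shifted infinite products of [Q n] to
   [P]; what remains is the 3phi2 term. *)
apply: cvg_seriesZ cv => n; rewrite phi32_termE /P /Q /g /saal_coef.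
rewrite (qpoch_infD (x * y * z) (2 * n) q1).
rewrite (qpoch_infD (x * z) n q1) (qpoch_infD (y * z) n q1) !invfM.
move: (qpoch_inf _ q)^-1 (qpoch_inf _ q)^-1 => A B.
move: (qpoch (x * z) q n)^-1 (qpoch (y * z) q n)^-1 => D E.
by ring.
Qed.

(** * The double series of the theorem *)

(** Second use of the exchange, with [wp_coef] as [g] and [watson_coef] as [h]: the rows are now
    evaluated by [watson_phi32] with x, y, u, v multiplied by q^n. *)
Lemma bailey_watson q x y z u v w : q != 0 -> `|q| < 1 -> `|z| < 1 ->
  `|w * z| < 1 -> `|x * z| < 1 -> `|y * z| < 1 -> `|u * w| < 1 -> `|v * w| < 1 ->
  `|x * y * z| < 1 -> x * y * z = u * v * w ->
  exists2 l : C,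
    series (fun n => qpoch_inf (x * y * z) q * qpoch_inf z q /
      (qpoch_inf (x * z) q * qpoch_inf (y * z) q) *
      (qpoch x q n * qpoch y q n * qpoch u q n * qpoch v q n /
       (qpoch q q n * qpoch (x * y * z) (q ^+ 2) n * qpoch (u * w) q n *
        qpoch (v * w) q n) * (w * z) ^+ n *
       phi32 (x * q ^+ n) (y * q ^+ n) w (u * w * q ^+ n) (v * w * q ^+ n) q z))
      @ \oo --> l &
    series (fun n => vwfac q (x * y * z) n * wp_coef q x y z u v w n *
      bailey_sum q (x * y * z) (watson_coef q (x * y * z)) n) @ \oo --> l.
Proof.
move=> q0 q1 z1 wz1 xz1 yz1 uw1 vw1 b1 e.
have q21 : `|q ^+ 2| < 1 by rewrite normrX expr_lt1.
have [M HM] : bnd (fun n =>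
    qpoch x q n * qpoch y q n * qpoch u q n * qpoch v q n *
    ((qpoch (u * w) q n)^-1 * (qpoch (v * w) q n)^-1 * (qpoch (x * z) q n)^-1 *
     (qpoch (y * z) q n)^-1)).
  by do ![apply: bndM]; try exact: bnd_qpoch; exact: bnd_qpochV.
have gM n : `|wp_coef q x y z u v w n| <= M * `|w * z| ^+ n.
  by rewrite /wp_coef normrM normrX ler_wpM2r ?exprn_ge0 // !invfM HM.
have hM : bnd (watson_coef q (x * y * z)).
  have [N HN] := bndM (bnd_qpochV q1 q1) (bnd_qpochV q21 b1).
  by exists N => n; rewrite /watson_coef invfM HN.
pose T n := qpoch_inf (x * y * z * q ^+ (2 * n)) q * qpoch_inf z q /
    (qpoch_inf (x * z * q ^+ n) q * qpoch_inf (y * z * q ^+ n) q) *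
    phi32 (x * q ^+ n) (y * q ^+ n) w (u * w * q ^+ n) (v * w * q ^+ n) q z.
have gL n : series (fun k => vwfac q (x * y * z * q ^+ (2 * n)) k * qcoef q k *
    wp_coef q x y z u v w (n + k)%N) @ \oo --> wp_coef q x y z u v w n * T n.
  have := @watson_phi32 q (x * q ^+ n) (y * q ^+ n) z (u * q ^+ n) (v * q ^+ n) w
    q0 q1 z1.
  have eb s t p : s * q ^+ n * (t * q ^+ n) * p = s * t * p * q ^+ (2 * n) :> C.
    by rewrite mul2n -addnn exprD; ring.
  rewrite !(mulrAC _ (q ^+ n) z) !(mulrAC _ (q ^+ n) w) !eb e => H.
  have {H} := H (normr_mulX_lt1 n q1 xz1) (normr_mulX_lt1 n q1 yz1)
    (normr_mulX_lt1 n q1 uw1) (normr_mulX_lt1 n q1 vw1) erefl.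
  rewrite -e -/(T n); apply: cvg_seriesZ => k.
  rewrite /wp_coef !(mulrAC _ (q ^+ n) z) !(mulrAC _ (q ^+ n) w) !qpochD exprD.
  rewrite !invfM.
  move: (qpoch (x * z) q n)^-1 (qpoch (y * z) q n)^-1 => A B.
  move: (qpoch (u * w) q n)^-1 (qpoch (v * w) q n)^-1 => D E.
  move: (qpoch (x * z * _) q k)^-1 (qpoch (y * z * _) q k)^-1 => A' B'.
  move: (qpoch (u * w * _) q k)^-1 (qpoch (v * w * _) q k)^-1 => D' E'.
  by ring.
have [l Hl Hl'] := bailey q0 q1 (normr_ge0 _) wz1 gM hM gL.
exists l => //; suff <- : series (fun n => qpoch (x * y * z) q (2 * n) *
    watson_coef q (x * y * z) n * (wp_coef q x y z u v w n * T n)) =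
    series (fun n => qpoch_inf (x * y * z) q * qpoch_inf z q /
      (qpoch_inf (x * z) q * qpoch_inf (y * z) q) *
      (qpoch x q n * qpoch y q n * qpoch u q n * qpoch v q n /
       (qpoch q q n * qpoch (x * y * z) (q ^+ 2) n * qpoch (u * w) q n *
        qpoch (v * w) q n) * (w * z) ^+ n *
       phi32 (x * q ^+ n) (y * q ^+ n) w (u * w * q ^+ n) (v * w * q ^+ n) q z)).
  exact: Hl.
congr series; apply/funext => n; rewrite /watson_coef /wp_coef /T.
rewrite (qpoch_infD (x * y * z) (2 * n) q1).
rewrite (qpoch_infD (x * z) n q1) (qpoch_infD (y * z) n q1) !invfM.
move: (qpoch_inf (x * z * q ^+ n) q)^-1 (qpoch_inf (y * z * q ^+ n) q)^-1 => A B.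
move: (qpoch (x * z) q n)^-1 (qpoch (y * z) q n)^-1 => D E.
move: (qpoch (u * w) q n)^-1 (qpoch (v * w) q n)^-1 => D' E'.
move: (phi32 _ _ _ _ _ _ _) (qpoch_inf (x * y * z * _) _) (qpoch_inf z _).
move=> F G H.
by ring.
Qed.

(** * The removable singularity at alpha = 1 *)

Lemma vwp_quotE q n x : x != 1 -> vwp_quot q n x = vwfac q (x * q) (2 * n).
Proof.
move=> x1; have x1' : 1 - x != 0 by rewrite subr_eq0 eq_sym.
case: n => [|n]; first by rewrite /vwp_quot muln0 qpoch0 expr0 !mulr1 divff.
rewrite /vwp_quot (_ : 4 * n.+1 = (2 * (2 * n).+1).+2)%N; last by lia.
rewrite (_ : 2 * n.+1 = (2 * n).+2)%N; last by lia.
rewrite [vwfac _ _ _]/= qpochSl (mulrCA _ (1 - x)) (mulrC (1 - x)) mulfK //.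
by rewrite (exprS q (2 * (2 * n).+1).+1) mulrA.
Qed.

Lemma cvg_vwfac q k : vwfac q (x * q) k @[x --> (1 : C)^'] --> vwfac q q k.
Proof.
have cx : (fun x : C => x * q) @ (1 : C)^' --> q.
  by rewrite -[X in _ --> X]mul1r; apply: cvgM; [exact: cvg_within | exact: cvg_cst].
have cf m : (1 - x * q * q ^+ m) @[x --> (1 : C)^'] --> 1 - q * q ^+ m.
  exact: (cvgB (cvg_cst _) (cvgM cx (cvg_cst _))).
case: k => [|k] /=; first exact: (cvg_cst (1 : C)).
apply: (cvgM (cf _)); elim: k => [|k IH].
  by under eq_fun do rewrite qpoch0; rewrite qpoch0; exact: (cvg_cst (1 : C)).
by under eq_fun do rewrite qpochS; rewrite qpochS; exact: (cvgM IH (cf k)).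
Qed.

(** Away from 1 the factor 1 - x cancels; at x = 1 the limit in [vwp] is the value there of the
    polynomial [vwfac], by continuity. *)
Lemma vwpE q n x : vwp q n x = vwfac q (x * q) (2 * n).
Proof.
rewrite /vwp; have [->|x1] := eqVneq x 1; last exact: vwp_quotE.
apply: cvg_lim; first exact: norm_hausdorff.
rewrite mul1r; apply: cvg_trans (@cvg_vwfac q (2 * n)); apply: near_eq_cvg.
near=> y; rewrite vwp_quotE //; near: y; exact: nbhs_dnbhs_neq.
Unshelve. all: by end_near. Qed.

(** * Specialisation to the parameters a, b, c, d, r *)

Lemma theorem6p6_complex_base q a b c d r alpha s : q != 0 -> `|q| < 1 ->
  `|a| < 1 -> `|b| < 1 -> `|c| < 1 -> `|d| < 1 -> `|r| < 1 ->
  alpha = a ^+ 2 * b * c * d * r / q -> s ^+ 2 = q * alpha ->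
  [/\ forall n : nat,
        cvgn (series (phi32_term (a * b * q ^+ n) (a * c * q ^+ n) (b * c)
          (a * b * c * d * q ^+ n) (a * b * c * r * q ^+ n) q (d * r))),
      cvgn (series (lhs_term q a b c d r s)),
      cvgn (series (rhs_term q a b c d r alpha)) &
      limn (series (lhs_term q a b c d r s))
      = qpochs_inf [:: a * b * d * r; a * c * d * r] q
        / qpochs_inf [:: d * r; q * alpha] q
        * limn (series (rhs_term q a b c d r alpha))].
Proof.
move=> q0 q1 a1 b1 c1 d1 r1 ea es.
have M1 (x y : C) : `|x| < 1 -> `|y| < 1 -> `|x * y| < 1.
  by move=> x1 y1; rewrite normrM mulr_ilt1.
have dr1 := M1 _ _ d1 r1.
have abcd1 : `|a * b * c * d| < 1 by do !apply: (M1).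
have abcr1 : `|a * b * c * r| < 1 by do !apply: (M1).
have abdr1 : `|a * b * d * r| < 1 by do !apply: (M1).
have acdr1 : `|a * c * d * r| < 1 by do !apply: (M1).
have bcdr1 : `|b * c * d * r| < 1 by do !apply: (M1).
have eb : a * b * (a * c) * (d * r) = q * alpha by rewrite ea; field.
have beta1 : `|q * alpha| < 1.
  by rewrite -eb; do !apply: (M1).
have eb' : q * alpha = a * d * (a * r) * (b * c) by rewrite -eb; ring.
have e1 : b * c * (d * r) = b * c * d * r by ring.
have e2 : a * b * (d * r) = a * b * d * r by ring.
have e3 : a * c * (d * r) = a * c * d * r by ring.
have e4 : a * d * (b * c) = a * b * c * d by ring.
have e5 : a * r * (b * c) = a * b * c * r by ring.
have := @bailey_watson q (a * b) (a * c) (d * r) (a * d) (a * r) (b * c) q0 q1 dr1.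
rewrite /wp_coef eb e1 e2 e3 e4 e5.
move=> /(_ bcdr1 abdr1 acdr1 abcd1 abcr1 beta1 eb')[l Hl Hr].
(* The inverse of [P] is the prefactor of the right-hand side. *)
set P := qpoch_inf _ q * _ / _ in Hl.
have n1 := qpoch_inf_neq0 q1 beta1; have n2 := qpoch_inf_neq0 q1 dr1.
have n3 := qpoch_inf_neq0 q1 abdr1; have n4 := qpoch_inf_neq0 q1 acdr1.
have P0 : P != 0 by exact: mulf_neq0 (mulf_neq0 n1 n2) (invr_neq0 (mulf_neq0 n3 n4)).
have cl : series (lhs_term q a b c d r s) @ \oo --> P^-1 * l.
  (* The square root enters only through (s; q)_n (-s; q)_n = (q alpha; q^2)_n. *)
  apply: cvg_seriesZ Hl => n; rewrite mulKf // /lhs_term /phi32.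
  rewrite /qpochs !big_cons !big_nil !mulr1 -es -qpoch_sqr !invfM; ring.
have cr : series (rhs_term q a b c d r alpha) @ \oo --> l.
  pose h m := vwfac q (q * alpha) m * (qpoch (a * b) q m * qpoch (a * c) q m *
    qpoch (a * d) q m * qpoch (a * r) q m / (qpoch (a * b * c * d) q m *
    qpoch (a * b * c * r) q m * qpoch (a * b * d * r) q m *
    qpoch (a * c * d * r) q m) * (b * c * d * r) ^+ m) *
    bailey_sum q (q * alpha) (watson_coef q (q * alpha)) m.
  (* Of each pair of terms 2m, 2m + 1 of [h] the odd one vanishes and the even one is [rhs_term] at
     m, so the right-hand partial sums are a subsequence of those of [h]. *)
  have E m : series (rhs_term q a b c d r alpha) m = series h (2 * m)%N.
    rewrite !seriesEord /=; elim: m => [|m IH]; first by rewrite !big_ord0.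
    rewrite big_ord_recr /= IH mulnS !big_ord_recr /= -addrA; congr (_ + _).
    rewrite /h bailey_sum_watson_odd // mulr0 addr0.
    rewrite bailey_sum_watson_even // /rhs_term vwpE.
    rewrite /qpochs !big_cons !big_nil !mulr1 (mulrC alpha q).
    by rewrite (_ : q * alpha / q = alpha) ?[q * alpha]mulrC ?mulfK // !invfM; ring.
  rewrite (_ : series _ = fun m => series h (2 * m)%N); last exact/funext.
  apply: (@cvg_comp _ _ _ (fun m => 2 * m)%N (series h) _ _ _ _ Hr).
  apply/cvgnyPge => A; exists A => // m /= Am.
  by rewrite (leq_trans Am) // leq_pmull.
split.
- move=> n; apply: is_cvg_phi32 => //; exact: normr_mulX_lt1.
- exact: cvgP cl.
- exact: cvgP cr.
rewrite (cvg_lim (@norm_hausdorff _ _) cl) (cvg_lim (@norm_hausdorff _ _) cr).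
rewrite /qpochs_inf !big_cons !big_nil !mulr1 /P invf_div.
rewrite (mulrC (qpoch_inf (d * r) q) (qpoch_inf (q * alpha) q)).
by [].
Qed.

End Analysis.

Theorem theorem6p6 (R : realType) (q : R) (a b c d r alpha s : R[i])
    (hq0 : 0 < q) (hq1 : q < 1)
    (ha : `|a| < 1) (hb : `|b| < 1) (hc : `|c| < 1) (hd : `|d| < 1)
    (hr : `|r| < 1)
    (halpha : alpha = a ^+ 2 * b * c * d * r / q%:C)
    (hs : s ^+ 2 = q%:C * alpha) :
  [/\ forall n : nat,
        cvgn (series (phi32_term (a * b * q%:C ^+ n) (a * c * q%:C ^+ n) (b * c)
          (a * b * c * d * q%:C ^+ n) (a * b * c * r * q%:C ^+ n)
          q%:C (d * r))),
      cvgn (series (lhs_term q%:C a b c d r s)),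
      cvgn (series (rhs_term q%:C a b c d r alpha)) &
      limn (series (lhs_term q%:C a b c d r s))
      = qpochs_inf [:: a * b * d * r; a * c * d * r] q%:C
        / qpochs_inf [:: d * r; q%:C * alpha] q%:C
        * limn (series (rhs_term q%:C a b c d r alpha))].
Proof.
have q1 : `|q%:C : (R[i] : numFieldType)| < 1.
  by rewrite normc_real gtr0_norm // (ltcR q 1).
have q0 : q%:C != 0 :> R[i] by rewrite (inj_eq (@complexI R) q 0) gt_eqF.
exact: theorem6p6_complex_base.
Qed.
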